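(* Let $(X,\mathcal{F})$ be a well-graded family. Then $$|ess_{\mathcal{F}}(X)|+1\le|\mathcal{F}|\le|E(G_{\mathcal{F}})|+1.$$
   Context: A set system $(X,\mathcal{F})$ is a finite set $X$ together with a nonempty family $\mathcal{F}$ of distinct subsets of $X$. Its one-inclusion graph $G_{\mathcal{F}}$ has a vertex $v_A$ for each $A\in\mathcal{F}$, with an edge (directed from $v_A$ to $v_B$, labelled $b$) whenever $B=A\cup\{b\}$ for some $b\in X\setminus A$; $E(G_{\mathcal{F}})$ is its edge set. The system is a well-graded family if for all $A,B\in\mathcal{F}$ the distance between $v_A$ and $v_B$ in the underlying undirected graph of $G_{\mathcal{F}}$ equals $|A\triangle B|$ (infinite distance if there is no path). $ess_{\mathcal{F}}(X)$ is the set of $x\in X$ for which there are $A,B\in\mathcal{F}$ with $x\in A$ and $x\notin B$. *)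

(* Defs.v *)
From mathcomp Require Import all_boot.

Set Implicit Arguments.
Unset Strict Implicit.
Unset Printing Implicit Defensive.

Section Distance.

Variables (V : finType) (e : rel V).

Definition walk (x y : V) (n : nat) : bool :=
  [exists p : n.-tuple V, path e x p && (last x p == y)].

Lemma connect_walk (x y : V) : connect e x y -> exists n, walk x y n.
Proof.
case/connectP => p ep ->; exists (size p).
by apply/existsP; exists (in_tuple p); rewrite ep eqxx.
Qed.

(* None stands for infinite distance. *)
Definition gdist (x y : V) : option nat :=
  match @idP (connect e x y) with
  | ReflectT xy => Some (ex_minn (connect_walk xy))
  | ReflectF _ => None
  end.

End Distance.

(* A set system on X is a nonempty F : {set {set X}}. *)
Section SetSystem.

Variables (X : finType) (F : {set {set X}}).

(* The triple (A, b, B) is the edge from A to B labelled b. *)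
Definition oig_edges : {set {set X} * X * {set X}} :=
  [set (A, b, b |: A) | A in F, b in ~: A & b |: A \in F].

Definition oig_adj : rel {set X} := fun A B =>
  [exists b, ((A, b, B) \in oig_edges) || ((B, b, A) \in oig_edges)].

Definition symdiff (A B : {set X}) : {set X} := (A :\: B) :|: (B :\: A).

(* All edges join members of F, so walks starting in F stay in F. *)
Definition well_graded : Prop :=
  forall A B, A \in F -> B \in F -> gdist oig_adj A B = Some #|symdiff A B|.

Definition ess : {set X} :=
  [set x | [exists A in F, x \in A] && [exists B in F, x \notin B]].

End SetSystem.

(* Main.v *)
Require Import Defs.
From mathcomp Require Import all_boot.

Set Implicit Arguments.
Unset Strict Implicit.
Unset Printing Implicit Defensive.

(** Fix a member A of F. By well-gradedness every other member B has a neighbour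
    B' in F on a geodesic to A, and A ∆ B' is A ∆ B with one element x removed.
    - Every x in ess F lies in some A ∆ B. When #|A ∆ B| is minimal, the element
      removed at B must be x, whatever neighbour B' is chosen; so a choice of
      removed elements maps F minus A onto a superset of ess F.
    - Sending an edge to its endpoint farther from A maps the edges onto a
      superset of F minus A. *)

Lemma in_symdiff (X : finType) (A B : {set X}) x :
  (x \in symdiff A B) = (x \in A) (+) (x \in B).
Proof. by rewrite !inE; case: (x \in A); case: (x \in B). Qed.

Lemma symdiff_eq0 (X : finType) (A B : {set X}) :
  (symdiff A B == set0) = (A == B).
Proof. by rewrite setU_eq0 !setD_eq0 eqEsubset. Qed.

Lemma symdiffC (X : finType) (A B : {set X}) : symdiff A B = symdiff B A.
Proof. exact: setUC. Qed.

(** [C] is [B] toggled at [x], so [symdiff A C] is [symdiff A B] toggled at [x]; the strict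
    inequality rules out that [x] was added. *)
Lemma symdiff_neighbour (X : finType) (A B C : {set X}) x :
  symdiff B C = [set x] -> #|symdiff A C| < #|symdiff A B| ->
  x \in symdiff A B /\ symdiff A C = symdiff A B :\ x.
Proof.
move=> /setP BCx ltCB.
have BC y : (y \in C) = (y \in B) (+) (y == x).
  by have := BCx y; rewrite in_symdiff inE => <-; rewrite addKb.
case xAB: (x \in symdiff A B); last first.
  suff /subset_leq_card : symdiff A B \subset symdiff A C by rewrite leqNgt ltCB.
  apply/subsetP=> y yAB; have: y != x by apply: contraTneq yAB => ->; rewrite xAB.
  by move: yAB; rewrite !in_symdiff BC => + /negPf->; rewrite addbF.
split=> //; apply/setP=> y; rewrite in_setD1 !in_symdiff BC.
case: eqVneq => [->|_]; last by rewrite addbF.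
by rewrite addbT addbN -in_symdiff xAB.
Qed.

Lemma gdist_walk (V : finType) (e : rel V) x y n :
  gdist e x y = Some n -> walk e x y n.
Proof.
by rewrite /gdist; case: {-}_ / idP => // xy [<-]; case: ex_minnP.
Qed.

Lemma gdist_le (V : finType) (e : rel V) x y n m :
  gdist e x y = Some n -> walk e x y m -> n <= m.
Proof.
rewrite /gdist; case: {-}_ / idP => // xy [<-]; case: ex_minnP => k _; exact.
Qed.

Lemma walkS (V : finType) (e : rel V) x y n :
  walk e x y n.+1 -> exists2 z, e x z & walk e z y n.
Proof.
case/existsP=> t; case/tupleP: t => z t /= /andP[/andP[xz zt] ty].
by exists z => //; apply/existsP; exists t; rewrite zt.
Qed.

Section SetSystemTheory.

Variables (X : finType) (F : {set {set X}}).
Implicit Types A B C : {set X}.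

Lemma oig_edgesP A b B :
  reflect [/\ A \in F, b \notin A, b |: A \in F & B = b |: A]
          ((A, b, B) \in oig_edges F).
Proof.
apply: (iffP imset2P) => [[C c CF]|[AF bA bAF ->]].
  by rewrite !inE => /andP[cC cCF] [-> -> ->].
by exists A b => //; rewrite !inE bA.
Qed.

Lemma oig_adj_symdiff A B :
  oig_adj F A B -> B \in F /\ exists x, symdiff A B = [set x].
Proof.
by case/existsP=> b /orP[] /oig_edgesP[? bA ? ->]; split=> //; exists b;
  apply/setP=> y; rewrite in_symdiff !inE; case: eqVneq => [->|_];
  rewrite ?(negPf bA) //= addbb.
Qed.

Hypothesis F_wg : well_graded F.

(** [C] is the first vertex after [B] on a shortest walk to [A]. The rest of that walk bounds the
    distance from [C] to [A], which well-gradedness identifies with the size of the symmetric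
    difference. *)
Lemma closer_neighbour A B : A \in F -> B \in F -> B != A ->
  exists C x, [/\ C \in F, oig_adj F B C, x \in symdiff A B &
                  symdiff A C = symdiff A B :\ x].
Proof.
move=> AF BF neqBA; have dBA := F_wg BF AF.
have := gdist_walk dBA; case En: #|_| => [|n].
  by move/eqP: En; rewrite cards_eq0 symdiff_eq0 (negPf neqBA).
case/walkS=> C BC wCA; have [CF [x Dx]] := oig_adj_symdiff BC.
have ltCB : #|symdiff A C| < #|symdiff A B|.
  rewrite symdiffC [symdiff A B]symdiffC En ltnS.
  exact: gdist_le (F_wg CF AF) wCA.
by have [? ?] := symdiff_neighbour Dx ltCB; exists C, x.
Qed.

(** Some member contains [x] and another omits it; [A] disagrees at [x] with one of the two. *)
Lemma ess_symdiff A x : x \in ess F -> exists2 B, B \in F & x \in symdiff A B.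
Proof.
rewrite inE => /andP[/exists_inP[B BF xB] /exists_inP[C CF xC]].
case xA: (x \in A); first by exists C; rewrite // in_symdiff xA (negPf xC).
by exists B; rewrite // in_symdiff xA xB.
Qed.

Lemma card_ess_wg A : A \in F -> #|ess F| <= #|F :\ A|.
Proof.
move=> AF; pose removable B x := (x \in symdiff A B) &&
  [exists C in F, symdiff A C == symdiff A B :\ x].
pose removed B := [pick x | removable B x].
(* As [removed] is option-valued, it is the copy of [ess F] under [Some] that gets covered by the
   image of [F :\ A]. *)
rewrite -(card_imset (mem (ess F)) Some_inj).
apply: leq_trans (leq_imset_card removed _); apply: subset_leq_card.
apply/subsetP=> _ /imsetP[x /(ess_symdiff A)[B0 B0F xB0] ->].
have PB0 : (B0 \in F) && (x \in symdiff A B0) by rewrite B0F.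
case: (@arg_minnP _ B0 (fun B => (B \in F) && (x \in symdiff A B))
  (fun B => #|symdiff A B|) PB0) => B /andP[BF xB] minB.
have neqBA : B != A.
  by rewrite eq_sym -symdiff_eq0; apply: contraTneq xB => ->; rewrite inE.
apply/imsetP; exists B; first by rewrite !inE neqBA.
rewrite /removed; case: pickP => [y /andP[yB]|no_removable].
  case/exists_inP=> C CF /eqP DC; congr Some.
  (* Otherwise [C] still differs from [A] at [x], while [symdiff A C] has lost [y], against the
     minimality of [B]. *)
  apply/eqP/contraT => neqxy.
  have := minB C; rewrite CF DC in_setD1 neqxy xB => /(_ isT).
  by rewrite leqNgt [#|symdiff A B|](cardsD1 y) yB ltnSn.
have [C [y [CF _ yB DC]]] := closer_neighbour AF BF neqBA.
by have /andP[] := no_removable y; split=> //; apply/exists_inP; exists C => //; apply/eqP.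
Qed.

Lemma card_wg_edges A : A \in F -> #|F :\ A| <= #|oig_edges F|.
Proof.
move=> AF; pose farther (e : {set X} * X * {set X}) :=
  if #|symdiff A e.1.1| < #|symdiff A e.2| then e.2 else e.1.1.
apply: leq_trans (leq_imset_card farther _); apply: subset_leq_card.
apply/subsetP=> B /setD1P[neqBA BF].
have [C [x [CF /existsP[b BC] xB DC]]] := closer_neighbour AF BF neqBA.
have ltCB : #|symdiff A C| < #|symdiff A B|.
  by rewrite DC [ltnRHS](cardsD1 x) xB.
(* The edge between [B] and [C] may be directed either way; in both cases the strict inequality
   makes [farther] select [B]. *)
apply/imsetP; case/orP: BC => BC.
  by exists (B, b, C) => //; rewrite /farther /= ltnNge ltnW.
by exists (C, b, B) => //; rewrite /farther /= ltCB.
Qed.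

End SetSystemTheory.

Theorem proposition3p1 (X : finType) (F : {set {set X}})
  (F_neq0 : F != set0) (F_wg : well_graded F) :
  #|ess F| + 1 <= #|F| <= #|oig_edges F| + 1.
Proof.
have /set0Pn[A AF] := F_neq0.
(* The removed member [A] accounts for the [+ 1] in both bounds. *)
by rewrite (cardsD1 A F) AF addnC !leq_add2l addnC leq_add2r card_ess_wg ?card_wg_edges.
Qed.
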